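(* Let $f:\mathbb{R}^n\to\mathbb{R}$ be a convex differentiable function possessing a minimizer $x^*$, and suppose that the gradient of $f$ satisfies the Hölder condition for some $\nu\in[0,1]$ with some finite constant $M_\nu$. Let $\varepsilon>0$, $x_0\in\mathbb{R}^n$, and let $L_0>0$ satisfy $$L_0\leq \inf_{\nu\in[0,1]}4\left[\frac{1-\nu}{1+\nu}\frac{M_\nu}{\varepsilon}\right]^{\frac{1-\nu}{1+\nu}}M_\nu .$$ Let $\Theta$ be any upper bound on $\frac12\|x_0-x^*\|^2$. Then the algorithm ULCM$(f,L_0,x_0,\varepsilon,T)$ outputs a point $y_T$ with $f(y_T)-f(x^* )\leq\varepsilon$ within a number of iterations bounded by $$\inf_{\nu\in[0,1]}\ \left[\frac{1-\nu}{1+\nu}\right]^{\frac{1-\nu}{1+3\nu}}\left[\frac{2^{\frac{3+5\nu}{2}}M_\nu}{\varepsilon}\right]^{\frac{2}{1+3\nu}}\Theta^{\frac{1+\nu}{1+3\nu}},$$ that is, for every integer $T\ge 0$ that is at least this quantity, the output $y_T$ satisfies $f(y_T)-f(x^* )\leq\varepsilon$.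
   Context: $\|\cdot\|$ is the Euclidean norm on $\mathbb{R}^n$. The gradient of $f$ satisfies the Hölder condition with exponent $\nu\in[0,1]$ and constant $M_\nu\ge 0$ if $\|\nabla f(x)-\nabla f(y)\|\leq M_\nu\|x-y\|^\nu$ for all $x,y\in\mathbb{R}^n$. For each $\nu\in[0,1]$, $M_\nu\in[0,+\infty]$ denotes such a constant, where $M_\nu=+\infty$ is allowed for those $\nu$ for which no finite constant exists (the corresponding expressions in the infima are then $+\infty$). In expressions of the form $[\cdot]^{\frac{1-\nu}{1+\nu}}$ or $[\cdot]^{\frac{1-\nu}{1+3\nu}}$, the value at $\nu=1$ is $1$ (convention $0^0=1$). Algorithm ULCM$(f,L_0,x_0,\varepsilon,T)$ (Universal Linear Coupling Method). Input: $f$, initial value $L_0>0$, initial point $x_0\in\mathbb{R}^n$, accuracy $\varepsilon>0$, number of iterations $T$. Set $y_0=z_0=x_0$, $\alpha_0=0$. For $k=0,1,\dots,T-1$: start with the trial value $L_{k+1}=L_k/2$ and repeat the following: - $\alpha_{k+1}=\frac{1}{2L_{k+1}}+\sqrt{\frac{1}{4L_{k+1}^2}+\alpha_k^2\frac{L_k}{L_{k+1}}}$, $\quad\tau_k=\frac{1}{\alpha_{k+1}L_{k+1}}$; - $x_{k+1}=\tau_kz_k+(1-\tau_k)y_k$; - $h_{k+1}\in\operatorname{argmin}_{h\geq0}f(x_{k+1}-h\nabla f(x_{k+1}))$, $\quad y_{k+1}=x_{k+1}-h_{k+1}\nabla f(x_{k+1})$; - $z_{k+1}=z_k-\alpha_{k+1}\nabla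 f(x_{k+1})$; - if $\langle\alpha_{k+1}\nabla f(x_{k+1}),z_k-z_{k+1}\rangle-\frac12\|z_k-z_{k+1}\|^2\leq\alpha_{k+1}^2L_{k+1}\left(f(x_{k+1})-f(y_{k+1})+\frac{\tau_k\varepsilon}{2}\right)$, accept the current values of $L_{k+1},\alpha_{k+1},\tau_k,x_{k+1},y_{k+1},z_{k+1}$ and pass to the next $k$; otherwise replace $L_{k+1}$ by $2L_{k+1}$ and repeat. Return $y_T$. It is assumed that the exact line search is always possible, i.e. the minimizers $h_{k+1}$ exist. *)

(* Defs.v *)
From HB Require Import structures.
From mathcomp Require Import all_boot all_order all_algebra.
From mathcomp Require Import all_classical all_reals all_analysis.

Set Implicit Arguments.
Unset Strict Implicit.
Unset Printing Implicit Defensive.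
Import Order.TTheory GRing.Theory Num.Theory.
Import numFieldNormedType.Exports.
Local Open Scope classical_set_scope.
Local Open Scope ring_scope.

(* The library norm `|v| on 'rV[R]_n is the sup norm, so the Euclidean one is
   defined here; differentiability is the same for both. *)
Definition dotp (R : realType) (n : nat) (u v : 'rV[R]_n) : R :=
  \sum_(i < n) u 0 i * v 0 i.

Definition enorm (R : realType) (n : nat) (v : 'rV[R]_n) : R :=
  Num.sqrt (dotp v v).

Definition grad (R : realType) (n : nat) (f : 'rV[R]_n -> R) (x : 'rV[R]_n) :
  'rV[R]_n := \row_(i < n) 'D_(delta_mx 0 i) f x.

(* At nu = 0 and x = y the right-hand side is m, since 0 `^ 0 = 1. *)
Definition hoelder_grad (R : realType) (n : nat) (f : 'rV[R]_n -> R)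
    (nu m : R) : Prop :=
  forall x y : 'rV[R]_n,
    enorm (grad f x - grad f y) <= m * enorm (x - y) `^ nu.

(* m is an admissible value of M_nu: a finite Hoelder constant, or +oo when
   there is no finite one. *)
Definition hoelder_const (R : realType) (n : nat) (f : 'rV[R]_n -> R)
    (nu : R) (m : \bar R) : Prop :=
  match m with
  | r%:E => 0 <= r /\ hoelder_grad f nu r
  | +oo%E => ~ exists r : R, 0 <= r /\ hoelder_grad f nu r
  | -oo%E => False
  end.

(* Both expressions below are +oo when M_nu = +oo, whatever nu and Theta are.
   The convention 0^0 = 1 is the one of powR. *)
Definition L0_expr (R : realType) (eps nu : R) (m : \bar R) : \bar R :=
  match m with
  | r%:E => (4 * ((1 - nu) / (1 + nu) * (r / eps)) `^ ((1 - nu) / (1 + nu))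
               * r)%:E
  | _ => +oo%E
  end.

Definition iter_expr (R : realType) (eps Theta nu : R) (m : \bar R) : \bar R :=
  match m with
  | r%:E => (((1 - nu) / (1 + nu)) `^ ((1 - nu) / (1 + 3 * nu))
             * (2 `^ ((3 + 5 * nu) / 2) * r / eps) `^ (2 / (1 + 3 * nu))
             * Theta `^ ((1 + nu) / (1 + 3 * nu)))%:E
  | _ => +oo%E
  end.

Definition L0_bound (R : realType) (eps : R) (M : R -> \bar R) : \bar R :=
  ereal_inf [set L0_expr eps nu (M nu) | nu in `[0, 1]].

Definition iter_bound (R : realType) (eps Theta : R) (M : R -> \bar R) :
  \bar R :=
  ereal_inf [set iter_expr eps Theta nu (M nu) | nu in `[0, 1]].

Definition line_search (R : realType) (n : nat) (f : 'rV[R]_n -> R)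
    (x : 'rV[R]_n) (h : R) : Prop :=
  0 <= h /\
  forall h' : R, 0 <= h' -> f (x - h *: grad f x) <= f (x - h' *: grad f x).

(* The values L_k, alpha_k, y_k, z_k with which iteration k starts. *)
Record iterate (R : realType) (n : nat) := Iterate {
  it_L : R;
  it_alpha : R;
  it_y : 'rV[R]_n;
  it_z : 'rV[R]_n
}.

Section Trial.
Variables (R : realType) (n : nat) (f : 'rV[R]_n -> R) (eps : R).
Variables (s : iterate R n) (L : R).

(* The values computed in iteration k (started in s) for the trial value
   L_{k+1} = L; h is the step h_{k+1} chosen by the line search. *)
Definition trial_alpha : R :=
  1 / (2 * L) + Num.sqrt (1 / (4 * L ^+ 2) + it_alpha s ^+ 2 * (it_L s / L)).

Definition trial_tau : R := 1 / (trial_alpha * L).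

Definition trial_x : 'rV[R]_n :=
  trial_tau *: it_z s + (1 - trial_tau) *: it_y s.

Definition trial_y (h : R) : 'rV[R]_n := trial_x - h *: grad f trial_x.

Definition trial_z : 'rV[R]_n := it_z s - trial_alpha *: grad f trial_x.

Definition trial_iterate (h : R) : iterate R n :=
  Iterate L trial_alpha (trial_y h) trial_z.

Definition trial_accepted (h : R) : Prop :=
  dotp (trial_alpha *: grad f trial_x) (it_z s - trial_z)
    - 1 / 2 * enorm (it_z s - trial_z) ^+ 2
  <= trial_alpha ^+ 2 * L
     * (f trial_x - f (trial_y h) + trial_tau * eps / 2).

End Trial.

Section Ulcm.
Variables (R : realType) (n : nat) (f : 'rV[R]_n -> R).
Variables (L0 : R) (x0 : 'rV[R]_n) (eps : R).
(* The argmin in the line search need not be unique: h k j is the step chosen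
   in trial j of iteration k (both counted from 0). Letting h vary gives all
   the executions of the algorithm. *)
Variable h : nat -> nat -> R.

Definition trial_L (s : iterate R n) (j : nat) : R := it_L s / 2 * 2 ^+ j.

Definition trial_reached (k : nat) (s : iterate R n) (j : nat) : Prop :=
  forall i : nat, (i < j)%N -> ~ trial_accepted f eps s (trial_L s i) (h k i).

(* ulcm_run k s: the first k iterations terminate and lead to s. *)
Inductive ulcm_run : nat -> iterate R n -> Prop :=
| UlcmInit : ulcm_run 0 (Iterate L0 0 x0 x0)
| UlcmStep (k : nat) (s : iterate R n) (j : nat) :
    ulcm_run k s ->
    trial_reached k s j ->
    trial_accepted f eps s (trial_L s j) (h k j) ->
    ulcm_run k.+1 (trial_iterate f s (trial_L s j) (h k j)).

(* Every step used in the first T iterations is an exact line search; nothing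
   is asked of h at trials that the execution does not reach. *)
Definition exact_line_search (T : nat) : Prop :=
  forall (k : nat) (s : iterate R n) (j : nat),
    (k < T)%N -> ulcm_run k s -> trial_reached k s j ->
    line_search f (trial_x s (trial_L s j)) (h k j).

Definition ulcm_output (T : nat) (y : 'rV[R]_n) : Prop :=
  exists2 s : iterate R n, ulcm_run T s & y = it_y s.

End Ulcm.

(* Main.v *)
Require Import Defs.
From HB Require Import structures.
From mathcomp Require Import all_boot all_order all_algebra.
From mathcomp Require Import all_classical all_reals all_analysis.
From mathcomp Require Import ring lra.
Import Order.TTheory GRing.Theory Num.Theory.
Import numFieldNormedType.Exports.
Local Open Scope classical_set_scope.
Local Open Scope ring_scope.

Set Implicit Arguments.
Unset Strict Implicit.
Unset Printing Implicit Defensive.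

(** Write p = (1 - nu) / (1 + nu) and, for an admissible pair (nu, M_nu),
    G = (p M_nu / eps)^p M_nu. With A_k = alpha_k^2 L_k, the quadratic equation
    solved by alpha_{k+1} says A_{k+1} = A_k + alpha_{k+1}, and
    u = 1 / tau_k = alpha_{k+1} L_{k+1} satisfies u^2 = A_{k+1} L_{k+1}.

    Progress. The acceptance test, the mirror step for z and convexity at
    x_{k+1} combine so that
      A_k (f(y_k) - f(xs) - eps / 2) + |z_k - xs|^2 / 2
    does not increase ([potential_step]). It starts below Theta, so
    A_T >= 2 Theta / eps forces f(y_T) - f(xs) <= eps.

    Growth of A_k. A gradient that is Hoelder continuous gives a descent
    inequality with the term |d|^(1 + nu) ([hoelder_descent]), and Young's
    inequality turns that term into a quadratic one plus delta / 2 as soon as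
    the coefficient L of the quadratic is at least (p M_nu / delta)^p M_nu
    ([powR_le_quadratic]). With delta = tau_k eps, a trial value L is accepted
    whenever L >= G u^p ([accepted_of_large]). As u grows only like the square
    root of L and p <= 1, the trials terminate; and as the value before an
    accepted one was rejected, L_{k+1} <= 2 G u^p ([trial_L_bound]). When the
    very first trial is accepted there is no rejected value, and the bound is
    inherited from the previous iteration, initially from the assumption on
    L_0. Together with u^2 = A_{k+1} L_{k+1} this bound on L_{k+1} makes
    2 (2 G A_k)^r, where r = (1 + nu) / (1 + 3 nu), grow by at least 1 in each
    iteration ([count_step]), whence T <= 2 (2 G A_T)^r.

    Conclusion. The term of index nu in the iteration bound is exactly
    2 (2 G B)^r with B = 2 Theta / eps ([iter_exprE]). Since the run satisfies
    T <= 2 (2 G A_T)^r for all nu at once, A_T < B would put the infimum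
    strictly above T ([iter_bound_gt]). For T = 0 the weight A_0 vanishes and
    says nothing; there the descent inequality at xs is used directly
    ([gap_le_smoothness], [iter_bound_ge1]). *)

(** * Euclidean geometry *)

Lemma dotpC (R : realType) (n : nat) (u v : 'rV[R]_n) : dotp u v = dotp v u.
Proof. by apply: eq_bigr => i _; rewrite mulrC. Qed.

Lemma dotpDl (R : realType) (n : nat) (u v w : 'rV[R]_n) :
  dotp (u + v) w = dotp u w + dotp v w.
Proof. by rewrite -big_split; apply: eq_bigr => i _; rewrite mxE mulrDl. Qed.

Lemma dotpZl (R : realType) (n : nat) (a : R) (u w : 'rV[R]_n) :
  dotp (a *: u) w = a * dotp u w.
Proof. by rewrite mulr_sumr; apply: eq_bigr => i _; rewrite mxE mulrA. Qed.

Lemma dotpNl (R : realType) (n : nat) (u w : 'rV[R]_n) :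
  dotp (- u) w = - dotp u w.
Proof. by rewrite -scaleN1r dotpZl mulN1r. Qed.

Lemma dotpDr (R : realType) (n : nat) (u v w : 'rV[R]_n) :
  dotp w (u + v) = dotp w u + dotp w v.
Proof. by rewrite dotpC dotpDl !(dotpC w). Qed.

Lemma dotpZr (R : realType) (n : nat) (a : R) (u w : 'rV[R]_n) :
  dotp w (a *: u) = a * dotp w u.
Proof. by rewrite dotpC dotpZl dotpC. Qed.

Lemma dotpNr (R : realType) (n : nat) (u w : 'rV[R]_n) :
  dotp w (- u) = - dotp w u.
Proof. by rewrite dotpC dotpNl dotpC. Qed.

Definition dotpE := (dotpDl, dotpNl, dotpZl, dotpDr, dotpNr, dotpZr).

Lemma dotp_ge0 (R : realType) (n : nat) (v : 'rV[R]_n) : 0 <= dotp v v.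
Proof. by apply: sumr_ge0 => i _; rewrite -expr2 sqr_ge0. Qed.

Lemma enorm_ge0 (R : realType) (n : nat) (v : 'rV[R]_n) : 0 <= enorm v.
Proof. exact: sqrtr_ge0. Qed.

Lemma sqr_enorm (R : realType) (n : nat) (v : 'rV[R]_n) :
  enorm v ^+ 2 = dotp v v.
Proof. by rewrite sqr_sqrtr// dotp_ge0. Qed.

Lemma enormZ (R : realType) (n : nat) (a : R) (v : 'rV[R]_n) :
  0 <= a -> enorm (a *: v) = a * enorm v.
Proof.
move=> a0; rewrite /enorm !dotpE mulrA -expr2 sqrtrM ?sqr_ge0//.
by rewrite sqrtr_sqr ger0_norm.
Qed.

Lemma dotp_le_enorm (R : realType) (n : nat) (u v : 'rV[R]_n) :
  dotp u v <= enorm u * enorm v.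
Proof.
have [uv0|uv0] := leP (dotp u v) 0.
  by apply: le_trans uv0 _; rewrite mulr_ge0// enorm_ge0.
have [v0|v0] := eqVneq (dotp v v) 0.
  suff : dotp u v = 0 by move=> h; rewrite h ltxx in uv0.
  apply: big1 => i _; move/eqP: v0; rewrite psumr_eq0.
    by move/allP => /(_ i (mem_index_enum _)); rewrite mulf_eq0 orbb
      => /eqP ->; rewrite mulr0.
  by move=> j _; rewrite -expr2 sqr_ge0.
have {v0} vv : 0 < dotp v v by rewrite lt0r v0 dotp_ge0.
rewrite -(@ler_pXn2r _ 2) ?nnegrE ?mulr_ge0 ?enorm_ge0 ?(ltW uv0)//.
rewrite exprMn !sqr_enorm.
(* The squared norm of |v|^2 u - <u, v> v is |v|^2 (|u|^2 |v|^2 - <u, v>^2). *)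
have := dotp_ge0 (dotp v v *: u - dotp u v *: v).
rewrite !dotpE (dotpC v u) => h.
rewrite -(ler_pM2l vv) -subr_ge0.
by apply: le_trans h _; rewrite le_eqVlt; apply/orP; left; apply/eqP; ring.
Qed.

(** * First-order bounds *)

Lemma derive_dotp_grad (R : realType) (n : nat) (f : 'rV[R]_n -> R)
    (x d : 'rV[R]_n) :
  differentiable f x -> 'D_d f x = dotp (grad f x) d.
Proof.
move=> df; rewrite deriveE// {1}(row_sum_delta d) linear_sum.
by apply: eq_bigr => i _; rewrite linearZ/= mxE deriveE// mulrC.
Qed.

(** Along a line the difference quotients of f coincide with those that define
    the directional derivative, so the one-variable mean value and extremum
    theorems become available for f. *)
Lemma is_derive_line (R : realType) (n : nat) (f : 'rV[R]_n -> R)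
    (x d : 'rV[R]_n) (t : R) :
  differentiable f (t *: d + x) ->
  is_derive t 1 (fun t : R => f (t *: d + x)) (dotp (grad f (t *: d + x)) d).
Proof.
move=> df.
have quotE : (fun h : R => h^-1 *: (((fun t : R => f (t *: d + x)) \o shift t)
      (h *: 1) - f (t *: d + x)))
    = (fun h : R => h^-1 *: ((f \o shift (t *: d + x)) (h *: d)
      - f (t *: d + x))).
  apply/funext => h /=; congr (_ *: (f _ - _)).
  by rewrite /shift/= scalerDl addrA [_%:A]mulr1.
split.
- by rewrite /derivable quotE; apply: diff_derivable.
- by rewrite /derive quotE; exact: derive_dotp_grad.
Qed.

(** Convexity bounds every difference quotient of f at x in the direction y - x
    with step at most 1 by f y - f x; the limit keeps the inequality. *)
Lemma convex_ge_tangent (R : realType) (n : nat) (f : 'rV[R]_n -> R)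
    (x y : 'rV[R]_n) :
  convex_function [set: 'rV[R]_n] f -> differentiable f x ->
  f x + dotp (grad f x) (y - x) <= f y.
Proof.
move=> cf df; rewrite -derive_dotp_grad// addrC -lerBrDr.
have dfx : derivable f x (y - x) by apply: diff_derivable.
have := cvg_dnbhs_at_right dfx.
move=> /cvgr_to_le; apply.
near=> h.
have h0 : 0 < h by near: h; exact: nbhs_right_gt.
have h1 : h <= 1 by near: h; apply: nbhs_right_le.
rewrite /= -[leLHS]/(h^-1 * _) mulrC ler_pdivrMr//.
have := cf (Itv01 (ltW h0) h1) y x (in_setT _) (in_setT _).
rewrite convRE /= /conv /= => /le_trans.
have -> : h *: (y - x) + x = h *: y + (1 - h) *: x.
  by rewrite scalerBl scale1r scalerBr -addrA (addrC x).
move=> H.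
rewrite lerBlDr; apply: H.
by rewrite /unstable.onem le_eqVlt; apply/orP; left; apply/eqP; ring.
Unshelve. all: by end_near.
Qed.

Lemma cvg_powR_right0 (R : realType) (a : R) :
  0 < a -> (x `^ a @[x --> 0^'+] --> (0 : R) `^ a).
Proof. by move=> a0; rewrite powR0 ?gt_eqF//; exact: powR_cvg0. Qed.

(** The function t |-> f (x + t d) - t <grad f x, d> - c t^(1 + nu), with c the
    coefficient that makes the Hoelder bound on the gradient say that its
    derivative is nonpositive on ]0, 1[, does not increase. The derivative of
    t^(1 + nu) at 0 is never needed, only continuity there. *)
Lemma hoelder_descent (R : realType) (n : nat) (f : 'rV[R]_n -> R) (nu m : R)
    (x d : 'rV[R]_n) :
  (forall x, differentiable f x) -> 0 <= nu -> hoelder_grad f nu m ->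
  f (x + d) <= f x + dotp (grad f x) d
               + m / (1 + nu) * enorm d `^ (1 + nu).
Proof.
move=> df nu0 hf.
have nu1 : 0 < 1 + nu by rewrite ltr_wpDr.
pose c := m / (1 + nu) * enorm d `^ (1 + nu).
pose phi t : R := f (t *: d + x) - t * dotp (grad f x) d - c * t `^ (1 + nu).
pose dphi t : R := dotp (grad f (t *: d + x)) d - dotp (grad f x) d
   - c * ((1 + nu) * t `^ nu).
have dphiE (t : R) : t \in `]0, 1[ -> is_derive t 1 phi (dphi t).
  rewrite in_itv/= => /andP[t0 t1].
  have h1 := is_derive_line (df (t *: d + x)).
  have h2 := is_derive1_powR (1 + nu) t0.
  have h3 : is_derive t 1 (fun t : R => t * dotp (grad f x) d)
      (dotp (grad f x) d).
    have -> : (fun t : R => t * dotp (grad f x) d) = dotp (grad f x) d \*: id.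
      by apply/funext => r /=; rewrite mulrC.
    by apply: is_derive_eq; rewrite [LHS]mulr1.
  have nuE : 1 + nu - 1 = nu by rewrite addrAC subrr add0r.
  rewrite nuE in h2; exact: is_deriveB (is_deriveB h1 h3) (is_deriveZ c h2).
have phic : {within `[0, 1], continuous phi}.
  have cf (t : R) : {for t, continuous (fun t : R => f (t *: d + x))}.
    apply: differentiable_continuous; apply/derivable1_diffP.
    by have [] := is_derive_line (df (t *: d + x)).
  apply/continuous_within_itvP => //; split.
  - move=> t t01; apply: differentiable_continuous; apply/derivable1_diffP.
    by have [] := dphiE _ t01.
  - apply: cvgB; first apply: cvgB.
    + exact/cvg_at_right_filter/cf.
    + apply: cvgM (cvg_cst _); apply: cvg_at_right_filter; exact: cvg_id.
    + apply: cvgM (cvg_cst _) _; exact: cvg_powR_right0.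
  - apply: cvg_at_left_filter; apply: cvgB; first apply: cvgB.
    + exact: cf.
    + apply: cvgM cvg_id (cvg_cst _).
    + apply: cvgM (cvg_cst _) _.
      have [/derivable1_diffP/differentiable_continuous + _] :=
        is_derive1_powR (1 + nu) (@ltr01 R).
      exact.
have [t t01 /eqP] := MVT ltr01 dphiE phic.
rewrite subr0 mulr1 subr_eq => /eqP.
rewrite /phi scale1r scale0r add0r mul1r mul0r powR1 mulr1 powR0 ?gt_eqF//.
rewrite mulr0 !subr0 => phi1.
suff : dphi t <= 0.
  move=> dphi0; rewrite (addrC x) -/c; lra.
move: t01; rewrite in_itv/= => /andP[t0 t1].
have := hf (t *: d + x) x; rewrite addrK enormZ ?(ltW t0)// => gt.
rewrite subr_le0 -dotpNl -dotpDl; apply: le_trans (dotp_le_enorm _ _) _.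
apply: le_trans (ler_wpM2r (enorm_ge0 _) gt) _.
rewrite powRM ?enorm_ge0 ?(ltW t0)// /c.
rewrite powRD ?(gt_eqF nu1)// powRr1 ?enorm_ge0//.
rewrite le_eqVlt; apply/orP; left; apply/eqP; field.
by rewrite gt_eqF.
Qed.

(** * Scalar inequalities *)

(** The exponent called p above. *)
Definition hexp (R : realType) (nu : R) : R := (1 - nu) / (1 + nu).

(** The smoothness constant of the inexact quadratic model of a function with
    Hoelder gradient, when the model may err by delta / 2. *)
Definition smoothness (R : realType) (delta nu m : R) : R :=
  (hexp nu * (m / delta)) `^ hexp nu * m.

(** The exponent r such that A_T grows at least like T^(1/r). *)
Definition rate (R : realType) (nu : R) : R := (1 + nu) / (1 + 3 * nu).

Lemma hexp_ge0 (R : realType) (nu : R) : 0 <= nu <= 1 -> 0 <= hexp nu.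
Proof. by move=> /andP[nu0 nu1]; rewrite divr_ge0 ?subr_ge0 ?addr_ge0. Qed.

Lemma hexp_le1 (R : realType) (nu : R) : 0 <= nu <= 1 -> hexp nu <= 1.
Proof. by move=> /andP[nu0 nu1]; rewrite ler_pdivrMr ?mul1r; lra. Qed.

Lemma rate_ge_half (R : realType) (nu : R) : 0 <= nu <= 1 -> 2^-1 <= rate nu.
Proof. by move=> /andP[nu0 nu1]; rewrite ler_pdivlMr; lra. Qed.

Lemma rate_gt0 (R : realType) (nu : R) : 0 <= nu <= 1 -> 0 < rate nu.
Proof. by move=> /rate_ge_half; apply: lt_le_trans; rewrite invr_gt0. Qed.

(** The exponents match: u^(2 - p), which is what the bound on L leaves of u^2,
    becomes u when raised to the rate. *)
Lemma rate_hexp (R : realType) (nu : R) :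
  0 <= nu <= 1 -> (2 - hexp nu) * rate nu = 1.
Proof.
by move=> /andP[nu0 nu1]; rewrite /hexp /rate; field; rewrite !gt_eqF//; lra.
Qed.

Lemma smoothness_gt0 (R : realType) (delta nu m : R) :
  0 <= nu <= 1 -> 0 < delta -> 0 < m -> 0 < smoothness delta nu m.
Proof.
move=> nu01 d0 m0; rewrite mulr_gt0//.
have [->|h0] := eqVneq (hexp nu) 0; first by rewrite powRr0.
have p0 : 0 < hexp nu by rewrite lt0r h0 hexp_ge0.
by rewrite powR_gt0// mulr_gt0// divr_gt0.
Qed.

Lemma powR_ge1 (R : realType) (x a : R) : 1 <= x -> 0 <= a -> 1 <= x `^ a.
Proof. by move=> x1 a0; rewrite -(powRr0 x); apply: ler_powR. Qed.

(** The graph of the concave power lies below its tangent at 1: Young's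
    inequality with one factor equal to 1. *)
Lemma powR_le_tangent1 (R : realType) (a x : R) :
  0 < a < 1 -> 0 <= x -> x `^ a <= 1 + a * (x - 1).
Proof.
move=> /andP[a0 a1] x0.
have b0 : 0 < 1 - a by rewrite subr_gt0.
have := @conjugate_powR _ (x `^ a) 1 a^-1 (1 - a)^-1 (powR_ge0 _ _) ler01.
rewrite !invr_gt0 !invrK subrKC powR1 -powRrM mulfV ?gt_eqF// powRr1//.
by move=> /(_ a0 b0 erefl); lra.
Qed.

(** As a function of t^2 the left-hand side is a concave power, and the
    right-hand side with the least admissible L is its tangent at the point
    where the constant term is delta / 2. With w = p m / delta this point is
    t^2 = w^(- (1 + p)), hence the argument t^2 w^(1 + p) of
    [powR_le_tangent1]. For nu = 1 the bound is already quadratic. *)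
Lemma powR_le_quadratic (R : realType) (delta nu m L t : R) :
  0 <= nu <= 1 -> 0 < delta -> 0 < m -> 0 <= t -> smoothness delta nu m <= L ->
  m / (1 + nu) * t `^ (1 + nu) <= L / 2 * t ^+ 2 + delta / 2.
Proof.
move=> nu01 d0 m0 t0 GL.
have GL' : smoothness delta nu m / 2 * t ^+ 2 + delta / 2
    <= L / 2 * t ^+ 2 + delta / 2.
  by rewrite lerD2r ler_wpM2r ?sqr_ge0// ler_wpM2r.
apply: (le_trans _ GL'); rewrite /smoothness /hexp.
move: nu01 => /andP[nu0]; rewrite le_eqVlt => /predU1P[->|nu1].
  rewrite subrr mul0r powRr0 mul1r -(powR_mulrn _ t0).
  by rewrite lerDl divr_ge0// ltW.
have nu1' : 0 < 1 + nu by lra.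
set p := (1 - nu) / (1 + nu).
have p0 : 0 < p by rewrite divr_gt0//; lra.
set w := p * (m / delta).
have w0 : 0 < w by rewrite mulr_gt0// divr_gt0.
(* The power a turns t^2 into t^(1 + nu) and w^(1 + p) into w. *)
pose a := (1 + nu) / 2.
have a01 : 0 < a < 1 by apply/andP; split; rewrite /a; lra.
have x0 : 0 <= t ^+ 2 * w `^ (1 + p).
  by rewrite mulr_ge0 ?powR_ge0 ?sqr_ge0.
have := powR_le_tangent1 a01 x0.
rewrite powRM ?sqr_ge0 ?powR_ge0// -powRrM -(powR_mulrn 2 t0) -powRrM.
have -> : (1 + p) * a = 1 by rewrite /p /a; field; rewrite gt_eqF.
have -> : 2%:R * a = 1 + nu by rewrite /a; field.
rewrite (powRr1 (ltW w0)) (@powRD _ w 1 p); last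
  by rewrite (gt_eqF w0) implybT.
rewrite (powRr1 (ltW w0)) powR_mulrn//.
rewrite -(ler_pM2r (_ : 0 < m / (1 + nu) / w)) ?divr_gt0// => H.
have e1 : t `^ (1 + nu) * w * (m / (1 + nu) / w)
    = m / (1 + nu) * t `^ (1 + nu).
  by field; rewrite !gt_eqF.
have e2 : (1 + a * (t ^+ 2 * (w * w `^ p) - 1)) * (m / (1 + nu) / w)
    = w `^ p * m / 2 * t ^+ 2 + delta / 2.
  suff -> : delta = m * p / w.
    by rewrite /a /p; field; rewrite !gt_eqF.
  by rewrite /w; field; rewrite !gt_eqF.
by rewrite e1 e2 in H.
Qed.

Lemma smoothnessZ (R : realType) (c delta nu m : R) :
  0 <= nu <= 1 -> 0 < c -> 0 < delta -> 0 < m ->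
  smoothness (c^-1 * delta) nu m = smoothness delta nu m * c `^ hexp nu.
Proof.
move=> nu01 c0 d0 m0; rewrite /smoothness.
have -> : hexp nu * (m / (c^-1 * delta)) = hexp nu * (m / delta) * c.
  by field; rewrite !gt_eqF.
rewrite powRM ?(ltW c0)//; first by rewrite mulrAC.
by rewrite mulr_ge0 ?hexp_ge0// divr_ge0 ?ltW.
Qed.

(** The terms of the iteration bound in the form in which the growth of A_k
    produces them. *)
Lemma iter_exprE (R : realType) (eps Theta nu m : R) :
  0 <= nu <= 1 -> 0 < eps -> 0 < m -> 0 <= Theta ->
  iter_expr eps Theta nu m%:E
  = (2 * (2 * smoothness eps nu m * (2 * Theta / eps)) `^ rate nu)%:E.
Proof.
move=> nu01 e0 m0 T0; have p0 := hexp_ge0 nu01.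
move: (nu01) => /andP[nu0 nu1].
have n1 : 0 < 1 + nu by lra.
have n3 : 0 < 1 + 3 * nu by lra.
have q0 : 0 < m / eps by rewrite divr_gt0.
rewrite /iter_expr; congr EFin; rewrite -/(hexp nu) -/(rate nu).
have -> : 2 * smoothness eps nu m * (2 * Theta / eps)
    = 4 * (hexp nu `^ hexp nu * (m / eps) `^ (hexp nu + 1)) * Theta.
  rewrite /smoothness powRM ?(ltW q0)// powRD; last first.
    by rewrite (gt_eqF q0) implybT.
  by rewrite (powRr1 (ltW q0)); ring.
have X0 : 0 <= hexp nu `^ hexp nu * (m / eps) `^ (hexp nu + 1).
  by rewrite mulr_ge0 ?powR_ge0.
rewrite [in RHS](powRM _ (mulr_ge0 _ X0) T0)//.
rewrite [in RHS](powRM _ _ X0)// [in RHS]powRM ?powR_ge0// -!powRrM.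
rewrite -[_ * m / eps]mulrA [in LHS]powRM ?powR_ge0 ?(ltW q0)// -powRrM.
have -> : hexp nu * rate nu = (1 - nu) / (1 + 3 * nu).
  by rewrite /hexp /rate; field; rewrite !gt_eqF.
have -> : (hexp nu + 1) * rate nu = 2 / (1 + 3 * nu).
  by rewrite /hexp /rate; field; rewrite !gt_eqF.
have -> : (3 + 5 * nu) / 2 * (2 / (1 + 3 * nu)) = 1 + 2 * rate nu.
  by rewrite /rate; field; rewrite !gt_eqF.
rewrite powRD; last by rewrite pnatr_eq0 implybT.
rewrite powRr1// powRrM powR_mulrn//.
have -> : 2 ^+ 2 = 4 :> R by ring.
by ring.
Qed.

(** It suffices to compare with the exponent 1/2, and
    1 - sqrt t - (1 - t) / 2 = (1 - sqrt t)^2 / 2. *)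
Lemma onem_powR_ge (R : realType) (t s : R) :
  0 <= t <= 1 -> 2^-1 <= s -> (1 - t) / 2 <= 1 - t `^ s.
Proof.
move=> /andP[t0 t1] s2.
have ts : t `^ s <= Num.sqrt t.
  have [->|tn0] := eqVneq t 0.
    by rewrite powR0 ?sqrtr_ge0// gt_eqF//; lra.
  have t0' : 0 < t by rewrite lt0r tn0.
  by rewrite -powR12_sqrt//; apply: ger_powR => //; rewrite t0' t1.
have := sqr_ge0 (1 - Num.sqrt t).
have := sqr_sqrtr t0.
nra.
Qed.

(** H u^2 and H (u^2 - u) stand for 2 G A_{k+1} and 2 G A_k, whose ratio is
    1 - 1/u. By [onem_powR_ge] the right-hand side is at least (H u^2)^s / u,
    and (H u^2)^s >= (u^(2 - p))^s = u. *)
Lemma powR_step_ge1 (R : realType) (p s H u : R) :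
  (2 - p) * s = 1 -> 2^-1 <= s -> 0 < H -> 1 <= u -> 1 <= H * u `^ p ->
  1 <= 2 * (H * u ^+ 2) `^ s - 2 * (H * (u ^+ 2 - u)) `^ s.
Proof.
move=> ps s2 H0 u1 Hu.
have u0 : 0 < u by lra.
have u0' := ltW u0.
have -> : H * (u ^+ 2 - u) = H * u ^+ 2 * (1 - u^-1).
  by field; rewrite gt_eqF.
have t0 : 0 <= 1 - u^-1 by rewrite subr_ge0 invf_le1.
rewrite [X in _ - _ * X]powRM ?mulr_ge0 ?sqr_ge0 ?(ltW H0)//.
have uHu : u <= (H * u ^+ 2) `^ s.
  have -> : H * u ^+ 2 = H * u `^ p * u `^ (2 - p).
    rewrite -mulrA -powRD ?subrKC ?powR_mulrn ?u0'//.
    by rewrite (gt_eqF u0) implybT.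
  rewrite powRM ?powR_ge0 ?mulr_ge0 ?powR_ge0 ?(ltW H0)//.
  rewrite -powRrM ps (powRr1 u0').
  rewrite (ler_peMl u0')//.
  by apply: powR_ge1 => //; lra.
have := @onem_powR_ge _ (1 - u^-1) s.
rewrite t0 gerBl invr_ge0 u0' subKr => /(_ isT s2) h.
have i0 : 0 <= u^-1 / 2 by rewrite divr_ge0// invr_ge0 ltW.
have := ler_pM u0' i0 uHu h.
by rewrite mulrA mulfV ?gt_eqF// mul1r; lra.
Qed.

(** * One iteration of the method *)

Definition weight (R : realType) (n : nat) (s : iterate R n) : R :=
  it_alpha s ^+ 2 * it_L s.

(** The value of 1 / tau_k for the trial value L when A_k = A. Unlike tau_k and
    alpha_{k+1}, it is visibly monotone in A and in L. *)
Definition inv_tau (R : realType) (A L : R) : R :=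
  2^-1 + Num.sqrt (4^-1 + A * L).

Section InvTau.
Variables (R : realType) (A L : R).
Hypotheses (A_ge0 : 0 <= A) (L_ge0 : 0 <= L).

Lemma inv_tau_ge1 : 1 <= inv_tau A L.
Proof.
have -> : 1 = 2^-1 + Num.sqrt ((2^-1) ^+ 2) :> R.
  by rewrite sqrtr_sqr ger0_norm ?invr_ge0//; field.
rewrite lerD2l ler_wsqrtr//.
have -> : 2^-1 ^+ 2 = 4^-1 :> R by field.
by rewrite lerDl mulr_ge0.
Qed.

(** The quadratic equation behind the choice of alpha_{k+1}. *)
Lemma inv_tau_sqr : inv_tau A L ^+ 2 = inv_tau A L + A * L.
Proof.
have h : 0 <= 4^-1 + A * L by rewrite addr_ge0 ?mulr_ge0 ?invr_ge0.
have := sqr_sqrtr h; rewrite /inv_tau; set r := Num.sqrt _ => hr.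
by rewrite sqrrD hr; field.
Qed.

End InvTau.

Lemma inv_tau_le (R : realType) (A L L' : R) :
  0 <= A -> L <= L' -> inv_tau A L <= inv_tau A L'.
Proof. by move=> A0 LL; rewrite lerD2l ler_wsqrtr// lerD2l ler_wpM2l. Qed.

Lemma inv_tau_le_of_quadratic (R : realType) (A L x : R) :
  0 <= A -> 0 <= L -> 0 < x -> x + A * L <= x ^+ 2 -> inv_tau A L <= x.
Proof.
move=> A0 L0 x0 hx; rewrite leNgt; apply/negP => ux.
have uE := inv_tau_sqr A0 L0; have u1 := inv_tau_ge1 A0 L0.
have : 0 < (inv_tau A L - x) * (inv_tau A L + x - 1) by rewrite mulr_gt0//; lra.
by rewrite -subr_gt0 in ux; lra.
Qed.

Section Step.
Variables (R : realType) (n : nat) (f : 'rV[R]_n -> R) (eps : R).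
Variables (s : iterate R n) (L : R).
Hypotheses (sL_ge0 : 0 <= it_L s) (L_gt0 : 0 < L).

Lemma weight_ge0 : 0 <= weight s.
Proof. by rewrite mulr_ge0 ?sqr_ge0. Qed.

Let u := inv_tau (weight s) L.

Let u_gt0 : 0 < u.
Proof. by apply: lt_le_trans (inv_tau_ge1 weight_ge0 (ltW L_gt0)). Qed.

Lemma trial_alphaE : trial_alpha s L = u / L.
Proof.
rewrite /trial_alpha /u /inv_tau [RHS]mulrDl; congr (_ + _).
  by field; rewrite gt_eqF.
have -> : 1 / (4 * L ^+ 2) + it_alpha s ^+ 2 * (it_L s / L)
    = (4^-1 + weight s * L) / L ^+ 2.
  by rewrite /weight; field; rewrite gt_eqF.
have h : 0 <= 4^-1 + weight s * L.
  by rewrite addr_ge0 ?invr_ge0// mulr_ge0 ?weight_ge0// ltW.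
rewrite sqrtrM//.
by rewrite sqrtrV ?sqr_ge0// sqrtr_sqr gtr0_norm.
Qed.

Lemma trial_tauE : trial_tau s L = u^-1.
Proof. by rewrite /trial_tau trial_alphaE divfK ?gt_eqF// mul1r. Qed.

Lemma weight_trial (h : R) :
  weight (trial_iterate f s L h) = u ^+ 2 / L.
Proof.
by rewrite /weight/= trial_alphaE; field; rewrite gt_eqF.
Qed.

Lemma trial_weightB (h : R) :
  weight (trial_iterate f s L h) - trial_alpha s L = weight s.
Proof.
rewrite weight_trial trial_alphaE (inv_tau_sqr weight_ge0 (ltW L_gt0)) -/u.
by field; rewrite gt_eqF.
Qed.

(** The acceptance test after inserting z_k - z_{k+1} = a grad f x and
    a^2 L tau = a. *)
Lemma trial_acceptedE (h : R) :
  trial_accepted f eps s L h <->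
  trial_alpha s L ^+ 2 / 2 * dotp (grad f (trial_x s L)) (grad f (trial_x s L))
  <= weight (trial_iterate f s L h)
     * (f (trial_x s L) - f (trial_y f s L h)) + trial_alpha s L * (eps / 2).
Proof.
have au : trial_alpha s L ^+ 2 * L * trial_tau s L = trial_alpha s L.
  by rewrite trial_tauE trial_alphaE; field; rewrite !gt_eqF.
rewrite /trial_accepted /trial_z /weight/= subKr sqr_enorm !dotpE.
set g := dotp _ _; set D := f _ - f _; set a := trial_alpha s L in au *.
have -> : a * (a * g) - 1 / 2 * (a * (a * g)) = a ^+ 2 / 2 * g by field.
have -> : a ^+ 2 * L * (D + trial_tau s L * eps / 2)
    = a ^+ 2 * L * D + a ^+ 2 * L * trial_tau s L * (eps / 2) by field.
by rewrite au.
Qed.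

(** The exact line search does at least as well as the step 1 / L, for which the
    inexact quadratic model with error tau eps / 2 gives a decrease of
    |g|^2 / (2 L) - tau eps / 2; this is the acceptance test. *)
Lemma accepted_of_large (nu m h : R) :
  (forall x, differentiable f x) -> 0 < eps -> 0 <= nu <= 1 -> 0 < m ->
  hoelder_grad f nu m -> line_search f (trial_x s L) h ->
  smoothness eps nu m * u `^ hexp nu <= L ->
  trial_accepted f eps s L h.
Proof.
move=> df e0 nu01 m0 hf [h0 hmin] GL; apply/trial_acceptedE.
set x := trial_x s L in hmin *; set g := grad f x in hmin *.
have Li0 : 0 <= L^-1 by rewrite invr_ge0 ltW.
have nu0 : 0 <= nu by case/andP: nu01.
have := hoelder_descent x (- L^-1 *: g) df nu0 hf.
rewrite -/g dotpZr scaleNr => fle.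
have nE : enorm (- (L^-1 *: g)) = L^-1 * enorm g.
  by rewrite -enormZ// /enorm dotpNl dotpNr opprK.
have d0 : 0 < u^-1 * eps by rewrite mulr_gt0 ?invr_gt0.
have t0 : 0 <= L^-1 * enorm g by rewrite mulr_ge0 ?enorm_ge0.
have := @powR_le_quadratic _ (u^-1 * eps) nu m L _ nu01 d0 m0 t0.
rewrite smoothnessZ// => /(_ GL).
rewrite -nE => Q; have := hmin L^-1 Li0.
move=> hm; have {}fle := le_trans (le_trans hm fle) (lerD (lexx _) Q).
rewrite nE exprMn sqr_enorm -/(trial_y f s L h) in fle.
have -> : weight (trial_iterate f s L h) = trial_alpha s L ^+ 2 * L by [].
rewrite trial_alphaE -/u.
set G := dotp g g in fle *; set y := trial_y f s L h in fle *.
have {}fle : G / (2 * L) <= f x - f y + u^-1 * eps / 2.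
  rewrite -subr_ge0; rewrite -subr_ge0 in fle.
  by apply: le_trans fle _; rewrite le_eqVlt; apply/orP; left; apply/eqP;
    field; rewrite !gt_eqF.
have W0 : 0 <= u ^+ 2 / L by rewrite divr_ge0 ?sqr_ge0 ?ltW.
have := ler_wpM2l W0 fle.
rewrite -subr_ge0 => H; rewrite -subr_ge0.
by apply: le_trans H _; rewrite le_eqVlt; apply/orP; left; apply/eqP;
    field; rewrite !gt_eqF.
Qed.

(** Subtracting eps / 2 from the gap absorbs the error that the acceptance test
    allows in each iteration, so that no error accumulates. *)
Definition potential (xs : 'rV[R]_n) (t : iterate R n) : R :=
  weight t * (f (it_y t) - f xs - eps / 2) + 1 / 2 * enorm (it_z t - xs) ^+ 2.

(** Linear coupling: x_{k+1} lies between z_k and y_k so that the part of the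
    mirror step that convexity does not control, a <g, x - z_k>, is traded for
    A_k <g, y_k - x>, which convexity bounds by A_k (f(y_k) - f(x)). What
    remains, a^2 |g|^2 / 2, is what the acceptance test bounds. *)
Lemma potential_step (xs : 'rV[R]_n) (h : R) :
  convex_function [set: 'rV[R]_n] f -> (forall x, differentiable f x) ->
  trial_accepted f eps s L h ->
  potential xs (trial_iterate f s L h) <= potential xs s.
Proof.
move=> cf df /trial_acceptedE.
have wB := trial_weightB h.
have a0 : 0 <= trial_alpha s L by rewrite trial_alphaE divr_ge0 ?ltW.
have wu : weight (trial_iterate f s L h) = trial_alpha s L * u.
  by rewrite weight_trial trial_alphaE; field; rewrite gt_eqF.
have xE : trial_x s L = u^-1 *: it_z s + (1 - u^-1) *: it_y s.
  by rewrite /trial_x trial_tauE.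
rewrite /potential [in X in _ -> X <= _]/= !sqr_enorm.
set x := trial_x s L in xE *; set g := grad f x; set y := trial_y f s L h.
set W := weight (trial_iterate f s L h) in wB wu *.
set a := trial_alpha s L in a0 wB wu *.
move=> acc.
have t1 := convex_ge_tangent xs cf (df x).
have t2 := convex_ge_tangent (it_y s) cf (df x).
have {}t1 := ler_wpM2l a0 t1.
have {}t2 := ler_wpM2l weight_ge0 t2.
(* Coupling: a (z - x) + A (y - x) = 0, as x is the average with weight 1/u. *)
have cpl : a * dotp g (it_z s - x) + weight s * dotp g (it_y s - x) = 0.
  rewrite -!dotpZr -dotpDr.
  have -> : a *: (it_z s - x) + weight s *: (it_y s - x) = 0; last first.
    by rewrite dotpC; apply: big1 => i _; rewrite mxE mul0r.
  apply/rowP => i; rewrite xE !mxE -wB wu; field.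
  by rewrite gt_eqF.
have e : dotp (it_z s - a *: g - xs) (it_z s - a *: g - xs)
    = dotp (it_z s - xs) (it_z s - xs) - 2 * a * dotp g (it_z s - xs)
      + a ^+ 2 * dotp g g.
  by rewrite !dotpE (dotpC g (it_z s)) (dotpC g xs); ring.
rewrite /trial_z -/x -/g -/a e.
have zx : dotp g (it_z s - xs) = dotp g (it_z s - x) - dotp g (xs - x).
  by rewrite !dotpE; ring.
rewrite zx.
move: t1 t2 cpl acc; rewrite -/g.
have -> : weight s = W - a by rewrite wB.
by lra.
Qed.

(** The bound on L passes to the first trial of the next iteration: halving L
    divides 1 / tau by at most 2, hence its power p <= 1 by at most 2. *)
Lemma smoothness_bound_half (G p h : R) : 0 <= p <= 1 -> 0 <= G ->
  L <= 2 * G * u `^ p ->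
  L / 2 <= 2 * G * inv_tau (weight (trial_iterate f s L h)) (L / 2) `^ p.
Proof.
move=> /andP[p0 p1] G0 LG.
set v := inv_tau _ _.
have uv : u <= 2 * v.
  rewrite /v /inv_tau weight_trial /=.
  have -> : u ^+ 2 / L * (L / 2) = u ^+ 2 / 2 by field; rewrite gt_eqF.
  have : Num.sqrt ((u / 2) ^+ 2) <= Num.sqrt (4^-1 + u ^+ 2 / 2).
    apply: ler_wsqrtr; have -> : (u / 2) ^+ 2 = u ^+ 2 / 4 by field.
    by have := sqr_ge0 u; lra.
  by rewrite sqrtr_sqr gtr0_norm ?divr_gt0//; lra.
have v0 : 0 <= v by have := u_gt0; lra.
clearbody v.
have : u `^ p <= 2 * v `^ p.
  apply: (@le_trans _ _ ((2 * v) `^ p)).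
    by apply: ge0_ler_powR => //; rewrite nnegrE ?mulr_ge0// ltW.
  have two_p : 2 `^ p <= 2 :> R by apply: ler1_powR => //; lra.
  by rewrite powRM//; exact: ler_wpM2r (powR_ge0 _ _) _ _ two_p.
move=> /(ler_wpM2l G0) /=; lra.
Qed.

(** [powR_step_ge1] with H = 2 G / L: the hypothesis on L is H u^p >= 1. *)
Lemma count_step (G nu h : R) (k : nat) : 0 <= nu <= 1 -> 0 < G ->
  L <= 2 * G * u `^ hexp nu ->
  k%:R <= 2 * (2 * G * weight s) `^ rate nu ->
  k.+1%:R <= 2 * (2 * G * weight (trial_iterate f s L h)) `^ rate nu.
Proof.
move=> nu01 G0 LG kle.
have H0 : 0 < 2 * G / L by rewrite divr_gt0 ?mulr_gt0.
have H1 : 1 <= 2 * G / L * u `^ hexp nu.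
  by rewrite mulrAC ler_pdivlMr// mul1r.
have := powR_step_ge1 (rate_hexp nu01) (rate_ge_half nu01) H0
  (inv_tau_ge1 weight_ge0 (ltW L_gt0)) H1.
have -> : 2 * G / L * (inv_tau (weight s) L ^+ 2 - inv_tau (weight s) L)
    = 2 * G * weight s.
  by rewrite (inv_tau_sqr weight_ge0 (ltW L_gt0)); field; rewrite gt_eqF.
rewrite weight_trial -/u.
have -> : 2 * G / L * u ^+ 2 = 2 * G * (u ^+ 2 / L) by field; rewrite gt_eqF.
by rewrite -natr1; lra.
Qed.

End Step.

(** * Executions of the method *)

Section Runs.
Variables (R : realType) (n : nat) (f : 'rV[R]_n -> R).
Variables (L0 : R) (x0 : 'rV[R]_n) (eps : R) (h : nat -> nat -> R).
Hypothesis L0_gt0 : 0 < L0.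

Let run := ulcm_run f L0 x0 eps h.

Lemma trial_L_gt0 (s : iterate R n) (j : nat) :
  0 < it_L s -> 0 < trial_L s j.
Proof. by move=> s0; rewrite /trial_L mulr_gt0 ?divr_gt0 ?exprn_gt0. Qed.

Lemma run_L_gt0 (k : nat) (s : iterate R n) : run k s -> 0 < it_L s.
Proof. by elim=> //= {}k {}s j _ s0 _ _; exact: trial_L_gt0. Qed.

Lemma run_weight_gt0 (k : nat) (s : iterate R n) :
  run k s -> (0 < k)%N -> 0 < weight s.
Proof.
elim=> // {}k {}s j rs _ _ _ _.
have s0 := run_L_gt0 rs; have L1 := trial_L_gt0 j s0.
have u1 := inv_tau_ge1 (weight_ge0 (ltW s0)) (ltW L1).
rewrite weight_trial//; last exact: ltW.
by rewrite divr_gt0// exprn_gt0// (lt_le_trans ltr01).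
Qed.

Lemma potential_run (xs : 'rV[R]_n) (k : nat) (s : iterate R n) :
  convex_function [set: 'rV[R]_n] f -> (forall x, differentiable f x) ->
  run k s -> potential f eps xs s <= 1 / 2 * enorm (x0 - xs) ^+ 2.
Proof.
move=> cf df; elim=> [|{}k {}s j rs IH _ acc].
  by rewrite /potential /weight /= expr0n/= !mul0r add0r.
have s0 := run_L_gt0 rs.
apply: le_trans IH; apply: potential_step => //; first exact: ltW.
exact: trial_L_gt0.
Qed.

Section Hoelder.
Variables (T : nat) (nu m : R).
Hypotheses (f_diff : forall x, differentiable f x) (eps_gt0 : 0 < eps).
Hypotheses (nu01 : 0 <= nu <= 1) (m_gt0 : 0 < m) (hf : hoelder_grad f nu m).
Hypothesis h_exact : exact_line_search f L0 x0 eps h T.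

Let G := smoothness eps nu m.

Let G_gt0 : 0 < G. Proof. exact: smoothness_gt0. Qed.

(** The contrapositive of [accepted_of_large]; the line search at trial j is
    exact because trial j is reached. *)
Lemma rejected_small (k j : nat) (s : iterate R n) :
  (k < T)%N -> run k s -> trial_reached f eps h k s j.+1 ->
  trial_L s j < G * inv_tau (weight s) (trial_L s j) `^ hexp nu.
Proof.
move=> kT rs sj; rewrite ltNge; apply/negP => GL.
apply: (sj j (ltnSn j)); have s0 := run_L_gt0 rs.
apply: (accepted_of_large _ _ f_diff eps_gt0 nu01 m_gt0 hf _ GL).
- exact: ltW.
- exact: trial_L_gt0.
- by apply: h_exact => // i ij; apply: sj; exact: ltnW.
Qed.

Lemma trial_L_bound (k j : nat) (s : iterate R n) :
  (k < T)%N -> run k s -> trial_reached f eps h k s j ->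
  it_L s / 2 <= 2 * G * inv_tau (weight s) (it_L s / 2) `^ hexp nu ->
  trial_L s j <= 2 * G * inv_tau (weight s) (trial_L s j) `^ hexp nu.
Proof.
move=> kT rs; have s0 := run_L_gt0 rs.
case: j => [_|j sj _]; first by rewrite /trial_L expr0 mulr1.
have LE : trial_L s j.+1 = 2 * trial_L s j by rewrite /trial_L exprS; ring.
have L'0 := trial_L_gt0 j s0.
have W0 := weight_ge0 (ltW s0).
apply: (@le_trans _ _ (2 * (G * inv_tau (weight s) (trial_L s j) `^ hexp nu))).
  by rewrite LE ler_wpM2l// ltW//; exact: (rejected_small kT).
rewrite mulrA ler_wpM2l//; first by rewrite mulr_ge0// ltW.
have le_tau : inv_tau (weight s) (trial_L s j)
    <= inv_tau (weight s) (trial_L s j.+1).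
  by apply: inv_tau_le => //; rewrite LE; lra.
have u1 := inv_tau_ge1 W0 (ltW L'0).
by apply: ge0_ler_powR; rewrite ?hexp_ge0// nnegrE; lra.
Qed.

(** The first bound is stated for the first trial value of the next iteration,
    because it is L_0 / 2 that the assumption on L_0 controls. *)
Lemma run_bounds (k : nat) (s : iterate R n) :
  L0 <= 4 * G -> run k s -> (k <= T)%N ->
  it_L s / 2 <= 2 * G * inv_tau (weight s) (it_L s / 2) `^ hexp nu /\
  k%:R <= 2 * (2 * G * weight s) `^ rate nu.
Proof.
move=> L0G; elim=> [_|{}k {}s j rs IH sj acc kT] /=.
  split; last by rewrite mulr_ge0// powR_ge0.
  apply: (@le_trans _ _ (2 * G)); first by rewrite ler_pdivrMr//; lra.
  have G2 : 0 <= 2 * G by rewrite mulr_ge0// ltW.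
  rewrite (ler_peMr G2)//.
  have W0 : 0 <= weight (Iterate L0 0 x0 x0) by apply: weight_ge0; exact: ltW.
  have L00 : 0 <= L0 / 2 by rewrite divr_ge0// ltW.
  exact: powR_ge1 (inv_tau_ge1 W0 L00) (hexp_ge0 nu01).
have s0 := run_L_gt0 rs.
have [IH1 IH2] := IH (ltnW kT).
have LG := trial_L_bound kT rs sj IH1.
split; last by apply: count_step => //; [exact: ltW|exact: trial_L_gt0].
apply: smoothness_bound_half => //.
- exact: ltW.
- exact: trial_L_gt0.
- by rewrite hexp_ge0// hexp_le1.
- exact: ltW.
Qed.

(** If all trials were rejected, L <= G u^p <= G u would hold for arbitrarily
    large L; but L >= G + G^2 A implies u <= L / G. *)
Lemma trial_accepted_exists (k : nat) (s : iterate R n) :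
  (k < T)%N -> run k s ->
  exists2 j, trial_reached f eps h k s j
           & trial_accepted f eps s (trial_L s j) (h k j).
Proof.
move=> kT rs; have s0 := run_L_gt0 rs.
pose acc j := `[< trial_accepted f eps s (trial_L s j) (h k j) >].
suff exj : exists j, acc j.
  have [j accj minj] := ex_minnP exj.
  exists j; last exact/asboolP.
  by move=> i ij acci; move: ij; rewrite ltnNge minj//; exact/asboolP.
apply: contrapT => noacc.
have reach j : trial_reached f eps h k s j.
  by move=> i _ acci; apply: noacc; exists i; exact/asboolP.
have W0 := weight_ge0 (ltW s0).
pose B := (G + G ^+ 2 * weight s) / (it_L s / 2).
pose j := Num.bound B.
have Lj : G + G ^+ 2 * weight s <= trial_L s j.
  rewrite [leRHS]mulrC -ler_pdivrMr ?divr_gt0//.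
  exact/ltW/upper_nthrootP.
have := rejected_small kT rs (reach j.+1).
have L'0 := trial_L_gt0 j s0.
move: L'0 Lj; set L := trial_L s j => L'0 Lj.
apply/negP; rewrite -leNgt.
have u1 := inv_tau_ge1 W0 (ltW L'0).
have uL : inv_tau (weight s) L <= L / G.
  apply: inv_tau_le_of_quadratic => //; [exact: ltW|exact: divr_gt0|].
  have -> : (L / G) ^+ 2 = L * L / G ^+ 2 by field; rewrite gt_eqF.
  have -> : L / G + weight s * L = L * (G + G ^+ 2 * weight s) / G ^+ 2.
    by field; rewrite gt_eqF.
  by rewrite ler_pM2r ?invr_gt0 ?exprn_gt0// ler_pM2l.
rewrite [leLHS]mulrC -ler_pdivlMr//; apply: le_trans uL.
by apply: ler1_powR => //; exact: hexp_le1.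
Qed.

Lemma run_exists (k : nat) : (k <= T)%N -> exists s, run k s.
Proof.
elim: k => [_|k IH kT]; first by eexists; exact: UlcmInit.
have [s rs] := IH (ltnW kT).
have [j sj acc] := trial_accepted_exists kT rs.
by eexists; exact: (UlcmStep rs sj acc).
Qed.

End Hoelder.
End Runs.

(** * The iteration bound *)

Lemma grad_min (R : realType) (n : nat) (f : 'rV[R]_n -> R)
    (xs d : 'rV[R]_n) :
  (forall x, differentiable f x) -> (forall x, f xs <= f x) ->
  dotp (grad f xs) d = 0.
Proof.
move=> df xs_min.
have dl t := is_derive_line (df (t *: d + xs)).
have [] := @derive1_at_min _ (fun t : R => f (t *: d + xs)) (-1) 1 0.
- by lra.
- by move=> t _; have [] := dl t.
- by rewrite in_itv/=; lra.
- by move=> t _; rewrite scale0r add0r.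
move=> _; have [_ ->] := dl 0.
by rewrite scale0r add0r.
Qed.

(** The inexact quadratic model at the minimizer, where the gradient is zero. *)
Lemma gap_le_smoothness (R : realType) (n : nat) (f : 'rV[R]_n -> R)
    (eps nu m : R) (x xs : 'rV[R]_n) :
  (forall x, differentiable f x) -> (forall x, f xs <= f x) ->
  0 < eps -> 0 <= nu <= 1 -> 0 < m -> hoelder_grad f nu m ->
  f x - f xs <= smoothness eps nu m / 2 * enorm (x - xs) ^+ 2 + eps / 2.
Proof.
move=> df xs_min e0 nu01 m0 hf.
have nu0 : 0 <= nu by case/andP: nu01.
have := hoelder_descent xs (x - xs) df nu0 hf.
rewrite grad_min// addrC subrK addr0 => fle.
have := powR_le_quadratic nu01 e0 m0 (enorm_ge0 (x - xs)) (lexx _).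
by lra.
Qed.

Lemma L0_le_smoothness (R : realType) (eps L0 nu m : R) (M : R -> \bar R) :
  (L0%:E <= L0_bound eps M)%E -> 0 <= nu <= 1 -> M nu = m%:E ->
  L0 <= 4 * smoothness eps nu m.
Proof.
move=> L0M nu01 Mnu; rewrite -lee_fin; apply: le_trans L0M _.
apply: ereal_inf_lbound; exists nu; first by rewrite /= in_itv.
by rewrite Mnu /= /smoothness mulrA.
Qed.

(** Every term of the infimum exceeds T by the factor (B / W)^r, with
    B = 2 Theta / eps, and this is at least (B / W)^(1/2), which does not depend
    on nu. The uniform factor matters as the infimum need not be attained. *)
Lemma iter_bound_gt (R : realType) (eps Theta W : R) (T : nat)
    (M : R -> \bar R) :
  0 < eps -> 0 <= Theta -> 0 < W -> W < 2 * Theta / eps -> (0 < T)%N ->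
  (forall nu m, 0 <= nu <= 1 -> M nu = m%:E ->
     0 < m /\ T%:R <= 2 * (2 * smoothness eps nu m * W) `^ rate nu) ->
  (forall nu, 0 <= nu <= 1 -> M nu != -oo%E) ->
  (T%:R%:E < iter_bound eps Theta M)%E.
Proof.
move=> e0 Theta0 W0 WB T0 bound MNy.
set B := 2 * Theta / eps in WB.
have BW : 1 < B / W by rewrite ltr_pdivlMr// mul1r.
(* The exponent 1/2 is the least value of the rate. *)
have c1 : 1 < (B / W) `^ 2^-1.
  have BW0 : 0 < B / W by apply: lt_trans BW.
  rewrite powR12_sqrt; last exact: ltW.
  by rewrite -[ltLHS]sqrtr1 ltr_sqrt.
apply: (@lt_le_trans _ _ (T%:R * (B / W) `^ 2^-1)%:E).
  by rewrite lte_fin ltr_pMr// ltr0n.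
apply: le_ereal_inf_tmp => _ [nu + <-]; rewrite /= in_itv/= => nu01.
case E : (M nu) => [m||]; [|exact: leey|by have := MNy _ nu01; rewrite E].
have [m0 Tle] := bound _ _ nu01 E.
rewrite iter_exprE// lee_fin -/B.
have G0 := smoothness_gt0 nu01 e0 m0.
have GW0 : 0 <= 2 * smoothness eps nu m * W.
  by apply: mulr_ge0; [rewrite mulr_ge0// ltW|exact: ltW].
have -> : 2 * smoothness eps nu m * B = 2 * smoothness eps nu m * W * (B / W).
  by field; rewrite gt_eqF.
rewrite [leRHS](congr1 _ (powRM _ GW0 (ltW (lt_trans ltr01 BW)))).
rewrite mulrA; apply: ler_pM => //; first exact: powR_ge0.
by apply: ler_powR (rate_ge_half nu01); exact: ltW.
Qed.

Lemma iter_bound_ge1 (R : realType) (eps Theta : R) (M : R -> \bar R) :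
  0 < eps -> 0 <= Theta ->
  (forall nu m, 0 <= nu <= 1 -> M nu = m%:E ->
     0 < m /\ eps / 2 < smoothness eps nu m * Theta) ->
  (forall nu, 0 <= nu <= 1 -> M nu != -oo%E) ->
  (1%:E <= iter_bound eps Theta M)%E.
Proof.
move=> e0 Theta0 bound MNy.
apply: le_ereal_inf_tmp => _ [nu + <-]; rewrite /= in_itv/= => nu01.
case E : (M nu) => [m||]; [|exact: leey|by have := MNy _ nu01; rewrite E].
have [m0 ltG] := bound _ _ nu01 E.
rewrite iter_exprE// lee_fin.
suff : 1 <= (2 * smoothness eps nu m * (2 * Theta / eps)) `^ rate nu by lra.
apply: powR_ge1; last exact: ltW (rate_gt0 nu01).
have -> : 2 * smoothness eps nu m * (2 * Theta / eps)
    = 4 * (smoothness eps nu m * Theta) / eps by field; rewrite gt_eqF.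
by rewrite ler_pdivlMr//; lra.
Qed.

Theorem theorem2p4 (R : realType) (n : nat) (f : 'rV[R]_n -> R)
    (xs : 'rV[R]_n) (M : R -> \bar R) (eps L0 Theta : R) (x0 : 'rV[R]_n)
    (f_convex : convex_function [set: 'rV[R]_n] f)
    (f_diff : forall x : 'rV[R]_n, differentiable f x)
    (xs_min : forall x : 'rV[R]_n, f xs <= f x)
    (f_hoelder : exists nu m : R,
       [/\ 0 <= nu <= 1, 0 <= m & hoelder_grad f nu m])
    (M_const : forall nu : R, 0 <= nu <= 1 -> hoelder_const f nu (M nu))
    (eps_gt0 : 0 < eps)
    (L0_gt0 : 0 < L0)
    (L0_le : (L0%:E <= L0_bound eps M)%E)
    (Theta_ge : 1 / 2 * enorm (x0 - xs) ^+ 2 <= Theta)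
    (T : nat)
    (T_ge : (iter_bound eps Theta M <= T%:R%:E)%E)
    (h : nat -> nat -> R)
    (h_exact : exact_line_search f L0 x0 eps h T) :
  (exists yT : 'rV[R]_n, ulcm_output f L0 x0 eps h T yT) /\
  (forall yT : 'rV[R]_n, ulcm_output f L0 x0 eps h T yT ->
     f yT - f xs <= eps).
Proof.
have L0G nu m : 0 <= nu <= 1 -> M nu = m%:E -> L0 <= 4 * smoothness eps nu m.
  by move=> nu01 Mnu; exact: L0_le_smoothness L0_le nu01 Mnu.
have MNy nu : 0 <= nu <= 1 -> M nu != -oo%E.
  by move=> /M_const; case: (M nu).
have const nu m : 0 <= nu <= 1 -> M nu = m%:E ->
    0 < m /\ hoelder_grad f nu m.
  move=> nu01 Mnu; have := M_const _ nu01; rewrite Mnu => -[m0 hf]; split=> //.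
  (* The constant 0 would make the bound on L0 equal to 0. *)
  rewrite lt0r m0 andbT; apply/eqP => m00.
  by have := L0G _ _ nu01 Mnu; rewrite m00 /smoothness mulr0; lra.
split.
  have [nu [m [nu01 m0 hf]]] := f_hoelder.
  have : exists r, M nu = r%:E.
    have := M_const _ nu01; case: (M nu) => [r _|noM|]//; first by exists r.
    by exfalso; apply: noM; exists m.
  move=> [r Mnu]; have [r0 hr] := const _ _ nu01 Mnu.
  have [s rs] := run_exists L0_gt0 f_diff eps_gt0 nu01 r0 hr h_exact (leqnn T).
  by exists (it_y s); exists s.
move=> _ [s rs ->].
have Theta0 : 0 <= Theta.
  by apply: le_trans Theta_ge; rewrite mulr_ge0 ?divr_ge0 ?sqr_ge0.
have s0 := run_L_gt0 L0_gt0 rs.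
have W0 := weight_ge0 (ltW s0).
have pot := le_trans (potential_run L0_gt0 xs f_convex f_diff rs) Theta_ge.
rewrite leNgt; apply/negP => gap.
have [T0|T0] := posnP T.
  move: T_ge rs; rewrite T0 => T_ge rs0.
  have sE : it_y s = x0 by inversion rs0.
  have : (1%:E <= iter_bound eps Theta M)%E.
    apply: iter_bound_ge1 => // nu m nu01 Mnu.
    have [m0 hf] := const _ _ nu01 Mnu; split=> //.
    have := gap_le_smoothness x0 f_diff xs_min eps_gt0 nu01 m0 hf.
    have G0 := smoothness_gt0 nu01 eps_gt0 m0.
    have := ler_wpM2l (ltW G0) Theta_ge.
    by rewrite sE in gap; lra.
  by move=> /le_trans /(_ T_ge); rewrite lee_fin ler10.
have bound nu m : 0 <= nu <= 1 -> M nu = m%:E ->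
    0 < m /\ T%:R <= 2 * (2 * smoothness eps nu m * weight s) `^ rate nu.
  move=> nu01 Mnu; have [m0 hf] := const _ _ nu01 Mnu; split=> //.
  by have [] := run_bounds L0_gt0 f_diff eps_gt0 nu01 m0 hf h_exact
    (L0G _ _ nu01 Mnu) rs (leqnn T).
have Wgt0 := run_weight_gt0 L0_gt0 rs T0.
have WB : weight s < 2 * Theta / eps.
  rewrite ltr_pdivlMr//.
  have gap' : eps / 2 < f (it_y s) - f xs - eps / 2 by lra.
  have := ltr_pM2l Wgt0 (eps / 2) (f (it_y s) - f xs - eps / 2).
  rewrite gap' => H.
  have z0 := sqr_ge0 (enorm (it_z s - xs)).
  by rewrite /potential in pot; lra.
have := iter_bound_gt eps_gt0 Theta0 Wgt0 WB T0 bound MNy.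
by rewrite ltNge T_ge.
Qed.
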